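(* Let $N\ge1$, $0\le K\le N$, and let $\alpha,\beta\in\mathcal{P}_{N,K}$ be paths with $\alpha$ weakly above $\beta$. There exists a bijection between labellings of the tree $A(\beta/\alpha)$ and configurations of Dyck strips between the paths $\alpha$ and $\beta$ satisfying Rule I.
   Context: **Paths.** $\mathcal{P}_{N,K}$ is the set of lattice paths from $(0,0)$ to $(N,2K-N)$ with $N$ steps, each $(1,1)$ or $(1,-1)$. Write $\alpha(x)$ for the height of $\alpha$ at abscissa $x\in\{0,\dots,N\}$. ''$\alpha$ weakly above $\beta$'' means $\alpha(x)\ge\beta(x)$ for all $x$. Paths are identified with binary strings in $\{1,2\}^N$ (convention $\epsilon=+$): the $i$-th letter is $1$ if the $i$-th step is $(1,1)$ and $2$ if it is $(1,-1)$. **Lascoux--Schützenberger tree.** Match letters of the string $\beta$ by parenthesis matching with $1$ as opening and $2$ as closing parenthesis (some letters may remain unmatched and are ignored). $A(\beta)$ is the rooted tree whose edges are in bijection with the matched pairs: the parent edge of the edge of a matched pair $(i,j)$ is the edge of the innermost matched pair $(k,l)$ with $k<i<j<l$, and the edge is attached to the root if no such pair exists. Leaf edges correspond exactly to the matched pairs $(j,j+1)$ of adjacent letters $\beta_j\beta_{j+1}=12$. The capacity of such a leaf edge relative to $\alpha$ is $$\#\{i\le j:\alpha_i=1\}-\#\{i\le j:\beta_i=1\},$$ which is non-negative. $A(\beta/\alpha)$ denotes the tree $A(\beta)$ together with these capacities at its leaves. A labelling of $A(\beta/\alpha)$ is an assignment of a non-negative integer to each edge such that the integer on each leaf edge is at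 most its capacity, and the integers are non-increasing from the leaves to the root (the label of an edge is at least the label of its parent edge). **Dyck strips.** The box $(x,y)$ is the 45-degree rotated unit box with center $(x,y)$ and corners $(x\pm1,y),(x,y\pm1)$. The box $(x,y-2)$ is just below $(x,y)$. A Dyck path of length $2l$, $l\ge0$, is a path with steps $(1,\pm1)$ from some $(x,y)\in\mathbb{Z}^2$ to $(x+2l,y)$ never going below height $y$. A Dyck strip of length $2l+1$ is the set of boxes centered at the vertices of a Dyck path of length $2l$. The boxes between $\alpha$ and $\beta$ are the $(x,y)$ with $x+y$ odd, $0<x<N$, $\beta(x)+1\le y\le\alpha(x)-1$. A configuration of Dyck strips between $\alpha$ and $\beta$ is a partition of this set of boxes into Dyck strips (no overlap, every box used; the empty configuration if $\alpha=\beta$). It satisfies Rule I if for every ordered pair $(D,D')$ of distinct strips in it: if there exists a box of $D$ just below a box of $D'$, then all boxes just below a box of $D'$ (including any lying outside the region) belong to $D$. *)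

(* Defs.v *)
From HB Require Import structures.
From mathcomp Require Import all_boot all_order all_algebra.
From mathcomp Require Import boolp classical_sets functions.
Set Implicit Arguments.
Unset Strict Implicit.
Unset Printing Implicit Defensive.
Import Order.TTheory GRing.Theory Num.Theory.
Local Open Scope classical_set_scope.
Local Open Scope ring_scope.

(* A path is encoded by its string of steps: [true] is the letter 1, i.e. the
   step (1,1), and [false] is the letter 2, i.e. the step (1,-1). *)
Definition height (s : seq bool) (x : nat) : int :=
  \sum_(b <- take x s) (if b then 1 else -1).

Definition lattice_paths (N K : nat) : set (N.-tuple bool) :=
  [set s : N.-tuple bool | height s N = 2 * K%:Z - N%:Z].
Arguments lattice_paths : clear implicits.

Definition weakly_above (N : nat) (alpha beta : N.-tuple bool) : Prop :=
  forall x : nat, (x <= N)%N -> height beta x <= height alpha x.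

(* The usual stack algorithm, [true] being an opening and [false] a closing
   parenthesis; [i] is the position of the first letter of [s] and [st] holds
   the positions of the opening parentheses that are still pending. *)
Fixpoint match_from (i : nat) (st : seq nat) (s : seq bool)
    : seq (nat * nat) :=
  match s, st with
  | [::], _ => [::]
  | true :: s', _ => match_from i.+1 (i :: st) s'
  | false :: s', k :: st' => (k, i) :: match_from i.+1 st' s'
  | false :: s', [::] => match_from i.+1 [::] s'
  end.

(* Positions are numbered from 1. *)
Definition matched_pairs (s : seq bool) : seq (nat * nat) :=
  match_from 1 [::] s.

Definition encloses (p q : nat * nat) : bool :=
  ((p.1 < q.1) && (q.2 < p.2))%N.

(* The tree A(beta) is given by its edges, which are the matched pairs, and by
   the relation "[e'] is the parent edge of [e]"; the edges without a parent
   edge are those attached to the root. *)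
Definition edge (beta : seq bool) : finType := seq_sub (matched_pairs beta).

Definition parent_edge (beta : seq bool) (e' e : edge beta) : bool :=
  encloses (val e') (val e) &&
  ~~ [exists e'' : edge beta,
        encloses (val e') (val e'') && encloses (val e'') (val e)].

Definition leaf_edge (beta : seq bool) (e : edge beta) : bool :=
  ~~ [exists e' : edge beta, parent_edge e e'].

(* Only meaningful when [e] is a leaf edge, given by the matched pair (j, j+1):
   the letters counted are those at the positions i <= j. *)
Definition capacity (alpha beta : seq bool) (e : edge beta) : int :=
  (count_mem true (take (val e).1 alpha))%:Z -
  (count_mem true (take (val e).1 beta))%:Z.

Definition labellings (alpha beta : seq bool) : set {ffun edge beta -> nat} :=
  [set n : {ffun edge beta -> nat} |
    (forall e : edge beta, leaf_edge e -> (n e)%:Z <= capacity alpha e) /\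
    (forall e e' : edge beta, parent_edge e' e -> (n e' <= n e)%N)].
Arguments labellings : clear implicits.

(* A box is given by its center. *)
Definition box : Type := (int * int)%type.

Definition below (b : box) : box := (b.1, b.2 - 2).

Definition dyck_word (w : seq bool) : Prop :=
  height w (size w) = 0 /\
  forall i : nat, (i <= size w)%N -> 0 <= height w i.

Definition dyck_strip (D : set box) : Prop :=
  exists (x y : int) (w : seq bool), dyck_word w /\
    D = [set (x + i%:Z, y + height w i) | i in [set i | (i <= size w)%N]].

Definition boxes_between (N : nat) (alpha beta : N.-tuple bool) : set box :=
  [set b : box | exists x : nat,
    [/\ b.1 = x%:Z, (0 < x < N)%N, odd (absz (b.1 + b.2)) &
        height beta x + 1 <= b.2 <= height alpha x - 1]].

Definition rule_I (C : set (set box)) : Prop :=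
  forall D D' : set box, C D -> C D' -> D <> D' ->
    (exists2 b : box, D' b & D (below b)) -> forall b : box, D' b -> D (below b).

Definition configurations (N : nat) (alpha beta : N.-tuple bool)
    : set (set (set box)) :=
  [set C : set (set box) |
    [/\ partition C id (boxes_between alpha beta),
        C `<=` dyck_strip & rule_I C]].

(* Main.v *)
Require Import Defs.
From HB Require Import structures.
From mathcomp Require Import all_boot all_order all_algebra zify.
From mathcomp Require Import boolp classical_sets functions.

(** Write h for the height of beta and gap x for half the distance from beta
    to alpha at abscissa x. The boxes between the paths are stacked over beta:
    the k-th box over x, for k < gap x, is centered at (x, h x + 1 + 2k), and
    k is called its level.

    Rule I makes the configurations rigid. A strip with a box resting on another
    strip rests on it entirely, so going down level by level every strip has all
    its boxes at one level ([configuration_level]). It is therefore a translate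
    of a piece of beta above an interval [i, j] of abscissas which is a Dyck
    path ([configuration_interval]). Rule I then says that the
    intervals at level k + 1 refine those at level k.

    A partition of the abscissas of one level into such intervals is a set of
    matched pairs of beta, those whose two ends lie in a common interval: this
    set contains every matched pair enclosed by one of its members, and it
    determines the intervals because a Dyck path is covered by the matched pairs
    that it contains ([dyck_interval_cover]). Refinement means that these sets
    decrease with k. So a configuration is a decreasing chain of sets of edges
    closed under passing to descendants, that is, the function n sending an edge
    to the number of levels that contain it, which does not increase towards
    the root. The strips are recovered as the blocks at level k of the relation
    that links abscissas when all the letters between them are covered by edges
    e with k < n e ([strips], [strips_labels]).

    It remains to express that the blocks stay between the paths: n e must be at
    most gap z for every abscissa z under e. Since gap does not increase along
    up steps of beta and does not decrease along down steps, its minimum under e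
    is reached at a peak of beta, that is at a leaf under e
    ([exists_peak_le_gap]), and the capacity is the gap at that peak. Hence the
    conditions at the leaves suffice ([labelling_le_gap]). *)

Set Implicit Arguments.
Unset Strict Implicit.
Unset Printing Implicit Defensive.

Section Heights.
Import Order.TTheory GRing.Theory Num.Theory.
Local Open Scope ring_scope.
Implicit Type s : seq bool.

(** * Heights, matched pairs and Dyck intervals *)

(** Letters are numbered from 1, so that letter x is the step that ends at
    abscissa x. *)
Definition letter s (x : nat) : bool := nth false s x.-1.

Lemma height_count s x : (x <= size s)%N ->
  height s x = 2 * (count_mem true (take x s))%:Z - x%:Z.
Proof.
rewrite /height => /size_takel; move: (take x s) => t <-.
elim: t => [|b t IHt]; first by rewrite big_nil.
by rewrite big_cons IHt /=; case: b => /=; lia.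
Qed.

Lemma height0 s : height s 0 = 0.
Proof. by rewrite /height take0 big_nil. Qed.

Lemma heightS s x : (x < size s)%N ->
  height s x.+1 = height s x + (if letter s x.+1 then 1 else -1).
Proof.
by move=> xs; rewrite /height (take_nth false xs) -cats1 big_cat big_seq1.
Qed.

Lemma height_drop s i t : height (drop i s) t = height s (i + t) - height s i.
Proof. by rewrite /height takeD big_cat [RHS]addrC addKr. Qed.

Lemma height_take s m t : (t <= m)%N -> height (take m s) t = height s t.
Proof. by move=> tm; rewrite /height take_takel. Qed.

(** A matched pair in terms of heights: the letters from p.1 to p.2 form a
    Dyck word that touches its base line only at its ends. *)
Definition prime_pair s (p : nat * nat) : Prop :=
  [/\ (0 < p.1 < p.2)%N, (p.2 <= size s)%N,
      height s p.1.-1 = height s p.2 &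
      forall x, (p.1 <= x < p.2)%N -> height s p.2 < height s x].

(** The invariant of the matching algorithm after m letters. The first part says
    which opening letters are pending; the second orders them, and implies that
    the top of the stack is the opening letter that starts at height h m - 1,
    where a closing letter m + 1 ends. *)
Definition pending_stack s (m : nat) (st : seq nat) : Prop :=
  (forall k : nat, k \in st <-> ((0 < k <= m)%N /\
     forall x, (k <= x <= m)%N -> height s k.-1 < height s x)) /\
  (forall t, (t < size st)%N ->
     height s (nth 0%N st t).-1 = height s m - t.+1%:Z).

Lemma pending_stack0 s : pending_stack s 0 [::].
Proof. by split=> // k; rewrite in_nil; split=> [//|[]]; lia. Qed.

Lemma pending_stack_open s m st : (m < size s)%N -> letter s m.+1 ->
  pending_stack s m st -> pending_stack s m.+1 (m.+1 :: st).
Proof.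
move=> ms up [memst htst]; have hS := heightS ms; rewrite up in hS.
split=> [k|[_|t]]; rewrite ?inE.
- split.
    case/orP => [/eqP->|/memst[km kx]].
      split=> [|x xm]; first lia.
      have -> : x = m.+1 by lia.
      by rewrite /=; lia.
    split=> [|x xm]; first lia.
    have [xm1|xm1] := leqP x m; first by apply: kx; lia.
    have -> : x = m.+1 by lia.
    by have := kx m; lia.
  case=> km kx; have [//|km1 /=] := eqVneq k m.+1.
  by apply/memst; split=> [|x xm]; [lia|apply: kx; lia].
- by rewrite /=; lia.
- by rewrite ltnS /= => /htst ->; lia.
Qed.

(** The closing letter comes down to the starting height of the top of the stack
    and stays above the starting heights of the deeper elements, so only the top
    stops being pending. *)
Lemma pending_stack_close s m st : (m < size s)%N -> ~~ letter s m.+1 ->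
  pending_stack s m st -> pending_stack s m.+1 (behead st).
Proof.
move=> ms down [memst htst]; have hS := heightS ms.
rewrite (negbTE down) in hS; split=> [k|t]; last first.
  by rewrite size_behead nth_behead => tst; rewrite htst; lia.
split=> [kst|[km kx]].
  have /memst[km kx] := mem_behead kst.
  split=> [|x xm]; first lia.
  have [xm1|xm1] := leqP x m; first by apply: kx; lia.
  have -> : x = m.+1 by lia.
  have := nth_index 0%N kst; rewrite nth_behead => <-.
  move: kst; rewrite -index_mem size_behead ltn_predRL => /htst ->.
  by rewrite hS; lia.
have : k \in st.
  apply/memst; split=> [|x xm]; last by apply: kx; lia.
  suff : k != m.+1 by lia.
  apply/eqP => km1; have := kx m.+1; rewrite km1 /=; lia.
case: st memst htst => // k' st _ /(_ 0%N isT) /= hk'.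
rewrite inE => /orP[/eqP kk'|//].
by have := kx m.+1; rewrite kk'; lia.
Qed.

(** The starting height of a pending letter determines its place in the stack,
    so only the top can start at the height where the closing letter ends. *)
Lemma pending_stack_close_prime s m st a : (m < size s)%N ->
  ~~ letter s m.+1 -> pending_stack s m st ->
  prime_pair s (a, m.+1) <-> ohead st = Some a.
Proof.
move=> ms down [memst htst]; have hS := heightS ms.
rewrite (negbTE down) in hS; split.
  case=> /= am _ ha hx.
  have ast : a \in st.
    apply/memst; split=> [|x xm]; first lia.
    by rewrite ha; apply: hx; lia.
  have := htst _ _; move: (ast); rewrite -index_mem => ist /(_ _ ist).
  rewrite nth_index // => hi.
  have i0 : index a st = 0%N by lia.
  by move: ast i0; case: (st) => //= b st' _; case: eqP => // ->.
case: st memst htst => // k st memst /(_ 0%N isT) /= hk [<-].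
have [km kx] : (0 < k <= m)%N /\
    forall x, (k <= x <= m)%N -> height s k.-1 < height s x.
  by apply/memst; rewrite mem_head.
split=> /=; [lia|lia|lia|move=> x xm].
by have := kx x; lia.
Qed.

(** Generalised over the letters r already read, so that the induction can
    follow the recursion of the algorithm. *)
Lemma match_fromP r s st (p : nat * nat) : pending_stack (r ++ s) (size r) st ->
  p \in match_from (size r).+1 st s <->
    (size r < p.2)%N /\ prime_pair (r ++ s) p.
Proof.
elim: s r st => [|b s IHs] r st inv.
  rewrite cats0 /=; split=> // -[pr [_ pr' _ _]]; lia.
have rs : (size r < size (r ++ b :: s))%N by rewrite size_cat /=; lia.
have letr : letter (r ++ b :: s) (size r).+1 = b.
  by rewrite /letter /= nth_cat ltnn subnn.
have IH st' : pending_stack (r ++ b :: s) (size r).+1 st' ->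
    p \in match_from (size r).+2 st' s <->
      ((size r).+1 < p.2)%N /\ prime_pair (r ++ b :: s) p.
  by have := IHs (rcons r b) st'; rewrite size_rcons cat_rcons.
have splitr : (size r < p.2)%N /\ prime_pair (r ++ b :: s) p <->
    p.2 = (size r).+1 /\ prime_pair (r ++ b :: s) p \/
    ((size r).+1 < p.2)%N /\ prime_pair (r ++ b :: s) p.
  split=> [[rp pp]|[[rp pp]|[rp pp]]]; try by split=> //; lia.
  have [->|rp'] := eqVneq p.2 (size r).+1; [by left|right; split=> //; lia].
case: b => [|] in rs letr inv IH splitr *.
  have -> /= : match_from (size r).+1 st (true :: s) =
      match_from (size r).+2 ((size r).+1 :: st) s by case: st {inv}.
  rewrite splitr; rewrite IH; last exact: pending_stack_open.
  split=> [|[[p2 [pp _ _ px]]|//]]; first by right.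
  have := heightS rs; rewrite letr => hS; have := px (size r).
  by rewrite p2 in pp px *; lia.
have close a := pending_stack_close_prime a rs (negbT letr) inv.
have {}IH := IH _ (pending_stack_close rs (negbT letr) inv).
rewrite splitr -IH; case: st {inv splitr IHs} IH close => [|k st] IH close.
  split=> [|[|//]]; first by right.
  by case: p {IH} => a c [/= ->] /close.
rewrite [match_from _ _ _]/= inE; split.
  case/orP=> [/eqP->|]; last by right.
  by left; split=> //; apply/close.
case=> [|->]; last by rewrite orbT.
by case: p {IH} => a c [/= ->] /close [->]; rewrite eqxx.
Qed.

Lemma matched_pairsP s (p : nat * nat) :
  p \in matched_pairs s <-> prime_pair s p.
Proof.
rewrite /matched_pairs (@match_fromP [::] s); last exact: pending_stack0.
by split=> [[]//|pp]; split=> //; case: pp => /=; lia.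
Qed.

Definition dyck_interval s i j : Prop :=
  [/\ (i <= j <= size s)%N, height s i = height s j &
      forall z, (i <= z <= j)%N -> height s i <= height s z].

(** The partner of an up step is the first return to its starting height; the
    partner of a down step leaves from the last earlier visit to its final
    height. Both stay within the interval because its end points are minima. *)
Lemma dyck_interval_cover s i j z : dyck_interval s i j -> (i < z <= j)%N ->
  exists2 p, prime_pair s p &
    [/\ (i < p.1)%N, (p.1 <= z <= p.2)%N & (p.2 <= j)%N].
Proof.
case=> ij hij hi; case: z => // z ziz.
have hz := @heightS s z; have [up|down] := boolP (letter s z.+1).
  have exP : exists t, (z < t)%N && (height s t <= height s z).
    by exists j; have := hi z; lia.
  case: (ex_minnP exP) => t /andP[zt htz] tmin.
  have tj : (t <= j)%N by apply: tmin; have := hi z; lia.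
  have min x : (z < x < t)%N -> height s z < height s x.
    by move=> xzt; rewrite ltNge; apply/negP => hx; have := tmin x; lia.
  have tz1 : t != z.+1 by apply/eqP => tz1; move: htz; rewrite tz1 hz ?up; lia.
  have := @heightS s t.-1; have := min t.-1.
  rewrite prednK; last lia.
  move=> ht1 ht; exists (z.+1, t); last by split=> /=; lia.
  have htz' : height s z = height s t by case: ifP ht; lia.
  by split=> //=; [lia|lia|move=> x zx; rewrite -htz'; apply: min; lia].
rewrite (negbTE down) in hz.
have exP : exists t, (t <= z)%N && (height s t <= height s z.+1).
  by exists i; have := hi z.+1; lia.
have ubP t : (t <= z)%N && (height s t <= height s z.+1) -> (t <= z)%N.
  by case/andP.
case: (ex_maxnP exP ubP) => t /andP[tz htz] tmax.
have it : (i <= t)%N by apply: tmax; have := hi z.+1; lia.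
have min x : (t < x < z.+1)%N -> height s z.+1 < height s x.
  by move=> xzt; rewrite ltNge; apply/negP => hx; have := tmax x; lia.
have tz1 : t != z by apply/eqP => tz1; move: htz; rewrite tz1 hz; lia.
have := @heightS s t; have := min t.+1 => ht1 ht.
exists (t.+1, z.+1); last by split=> /=; lia.
have htz' : height s t = height s z.+1 by case: ifP ht; lia.
by split=> //=; [lia|lia].
Qed.

Lemma prime_pair_dyck s p : prime_pair s p -> dyck_interval s p.1.-1 p.2.
Proof.
case=> p0 ps hp hx; split=> // [|z zp]; first lia.
have [->|zp1] := eqVneq z p.1.-1; first by [].
have [->|zp2] := eqVneq z p.2; first by rewrite hp.
by have := hx z; lia.
Qed.

Lemma prime_pair_up s p : prime_pair s p -> letter s p.1.
Proof.
case=> p0 ps hp hx; have := @heightS s p.1.-1; have := hx p.1.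
by rewrite prednK; [case: (letter _ _) => //; lia|lia].
Qed.

Lemma prime_pair_down s p : prime_pair s p -> ~~ letter s p.2.
Proof.
case=> p0 ps hp hx; have := @heightS s p.2.-1; have := hx p.2.-1.
rewrite prednK; last lia.
have [p12|p12] := eqVneq p.2.-1 p.1.-1; first by lia.
by case: (letter _ _) => //; lia.
Qed.

(** Two matched pairs that share a letter are nested: if they crossed, an end of
    each would be strictly inside the other, and each end would have to be
    strictly higher than the other. Nor can an opening letter of one be a
    closing letter of the other. *)
Lemma prime_pair_laminar s p q z : prime_pair s p -> prime_pair s q ->
    (p.1 <= z <= p.2)%N -> (q.1 <= z <= q.2)%N ->
  [\/ p = q, encloses p q | encloses q p].
Proof.
move=> pp pq zp zq; have := prime_pair_up pp; have := prime_pair_down pp.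
have := prime_pair_up pq; have := prime_pair_down pq.
case: p q pp pq zp zq => [a b] [c d] [/= ab bs hab hx] [/= cd ds hcd hy] zp zq.
move=> ld lc lb la; rewrite /encloses /=.
have bc : b != c by apply/eqP => bc; rewrite bc lc in lb.
have ad : a != d by apply/eqP => ad; rewrite -ad la in ld.
have := hx c.-1; have := hx d; have := hx c.
have := hy a.-1; have := hy b; have := hy a.
have [ac|ac|ac] := ltngtP a c; have [bd|bd|bd] := ltngtP b d;
  try (by constructor 2; lia); try (by constructor 3; lia);
  try by subst; try constructor 1 => //; lia.
all: try (subst; lia).
Qed.

(** * Labels under an edge *)

(** A name for the projection, so that all its occurrences are syntactically
    equal and arithmetic tactics see them as one term. *)
Definition ends s (e : edge s) : nat * nat := val e.

Lemma ends_inj s : injective (@ends s).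
Proof. exact: val_inj. Qed.

Lemma parent_edgeE s (e f : edge s) : parent_edge e f =
  encloses (ends e) (ends f) &&
  ~~ [exists g : edge s,
        encloses (ends e) (ends g) && encloses (ends g) (ends f)].
Proof. by []. Qed.

Lemma capacityE alpha beta (e : edge beta) : capacity alpha e =
  (count_mem true (take (ends e).1 alpha))%:Z -
  (count_mem true (take (ends e).1 beta))%:Z.
Proof. by []. Qed.

Lemma edge_prime s (e : edge s) : prime_pair s (ends e).
Proof. exact/matched_pairsP/ssvalP. Qed.

Lemma prime_edge s p : prime_pair s p -> exists e : edge s, ends e = p.
Proof. by move/matched_pairsP => ps; exists (SeqSub ps). Qed.

Lemma encloses_cmp s (e f : edge s) :
    ((ends e).1 <= (ends f).1)%N -> ((ends f).2 <= (ends e).2)%N ->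
  e = f \/ encloses (ends e) (ends f).
Proof.
move=> ef1 ef2; have pf := edge_prime f; have [f12 _ _ _] := pf.
case: (@prime_pair_laminar s (ends e) (ends f) (ends f).1 (edge_prime e) pf).
- by lia.
- by lia.
- by move/ends_inj; left.
- by right.
- by rewrite /encloses; lia.
Qed.

(** The labels are only compared along parent edges; an edge that encloses
    another one without being its parent has a third edge in between. *)
Lemma labelling_nested alpha beta n (e f : edge beta) :
    labellings alpha beta n ->
    ((ends e).1 <= (ends f).1)%N -> ((ends f).2 <= (ends e).2)%N ->
  (n e <= n f)%N.
Proof.
case=> _ nparent; move: {2}_.+1 (ltnSn ((ends e).2 - (ends f).2)) => m.
elim: m e f => // m IHm e f em ef1 ef2.
have [->//|ef] := encloses_cmp ef1 ef2.
have [/nparent//|] := boolP (parent_edge e f).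
rewrite parent_edgeE ef /= negbK => /existsP[g /andP[]].
rewrite /encloses => /andP[eg1 ge2] /andP[gf1 fg2].
by apply: (@leq_trans (n g)); apply: IHm; lia.
Qed.

Section Gap.
Variables (N : nat) (alpha beta : N.-tuple bool).
Implicit Types (n : {ffun edge beta -> nat}) (k l x y z : nat) (b : box).

(** Half the difference of heights, hence the number of boxes over x; at the
    opening letter of a leaf edge this is its capacity. *)
Definition gap (x : nat) : int :=
  (count_mem true (take x alpha))%:Z - (count_mem true (take x beta))%:Z.

Lemma gap_height x : (x <= N)%N ->
  height alpha x = height beta x + 2 * gap x.
Proof. by move=> xN; rewrite !height_count ?size_tuple // /gap; lia. Qed.

Lemma gapS x : (x < N)%N ->
  gap x.+1 = gap x + (letter alpha x.+1 : nat)%:Z - (letter beta x.+1 : nat)%:Z.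
Proof.
move=> xN; rewrite /gap !(take_nth false) ?size_tuple // -!cats1 !count_cat /=.
by rewrite /letter /= !eqb_id; lia.
Qed.

Lemma gap_up x y : (x <= y <= N)%N ->
    (forall z, (x < z <= y)%N -> letter beta z) ->
  gap y <= gap x.
Proof.
elim: y => [|y IHy] xy up; first by have -> : x = 0%N by lia.
have [->//|xy1] := eqVneq x y.+1; rewrite gapS ?up; try lia.
have h : gap y <= gap x by apply: IHy => [|z xz]; [lia|apply: up; lia].
by case: (letter _ _) => /=; lia.
Qed.

Lemma gap_down x y : (x <= y <= N)%N ->
    (forall z, (x < z <= y)%N -> ~~ letter beta z) ->
  gap x <= gap y.
Proof.
elim: y => [|y IHy] xy down; first by have -> : x = 0%N by lia.
have [->//|xy1] := eqVneq x y.+1; rewrite gapS ?(negbTE (down _ _)); try lia.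
have h : gap x <= gap y by apply: IHy => [|z xz]; [lia|apply: down; lia].
by case: (letter _ _) => /=; lia.
Qed.

(** From z, go down the gap: forward along the up steps of beta if an up step
    follows, otherwise backward along its down steps. Both walks stop at a peak,
    at the latest at the last (resp. first) peak under p. *)
Lemma exists_peak_le_gap p z : prime_pair beta p -> (p.1.-1 <= z <= p.2)%N ->
  exists t, [/\ (p.1 <= t < p.2)%N, letter beta t, ~~ letter beta t.+1 &
    gap t <= gap z].
Proof.
move=> pp zp; have := prime_pair_up pp; have := prime_pair_down pp.
case: pp => p12 pN _ _ down up; rewrite size_tuple in pN.
have [zup|zdown] := boolP ((z < p.2)%N && letter beta z.+1).
  have exP : exists t, (z < t)%N && ~~ letter beta t.+1.
    exists p.2.-1; rewrite prednK ?down; last lia.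
    case/andP: zup => zp2 zup; suff : z.+1 != p.2 by lia.
    by apply: contraNneq down => <-.
  case: (ex_minnP exP) => t /andP[zt dt] tmin; exists t.
  have min x : (z < x <= t)%N -> letter beta x.
    move=> zx; have [->|xz] := eqVneq x z.+1; first by case/andP: zup.
    apply/negPn/negP => dx; have := tmin x.-1; rewrite prednK; last lia.
    by rewrite dx; lia.
  have tp : (t < p.2)%N.
    have := tmin p.2.-1; rewrite prednK ?down; last lia.
    case/andP: zup => zp2 zup; suff : z.+1 != p.2 by lia.
    by apply: contraNneq down => <-.
  split=> //; [lia|by apply: min; lia|].
  by apply: gap_up => //; lia.
have zp1 : z != p.1.-1.
  apply: contraNneq zdown => ->; rewrite prednK; last lia.
  by rewrite up andbT; lia.
have exP : exists t, (t <= z)%N && letter beta t by exists p.1; rewrite up; lia.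
have ubP t : (t <= z)%N && letter beta t -> (t <= z)%N by case/andP.
case: (ex_maxnP exP ubP) => t /andP[tz ut] tmax; exists t.
have max x : (t < x <= z)%N -> ~~ letter beta x.
  by move=> tx; apply/negP => ux; have := tmax x; rewrite ux; lia.
have pt : (p.1 <= t)%N by apply: tmax; rewrite up; lia.
have tp : (t < p.2)%N.
  have : t != p.2 by apply: contraNneq down => <-.
  by lia.
split=> //; first lia.
  have [tz1|tz1] := eqVneq t z; last by apply: max; lia.
  by apply: contraNN zdown => uz; rewrite -tz1 uz tp.
by apply: gap_down => //; lia.
Qed.

Lemma peak_prime t : (0 < t < N)%N -> letter beta t -> ~~ letter beta t.+1 ->
  prime_pair beta (t, t.+1).
Proof.
move=> tN up down; have := @heightS beta t.-1; have := @heightS beta t.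
rewrite prednK; last lia.
rewrite size_tuple up (negbTE down) => h1 h2.
split=> /=; rewrite ?size_tuple; try lia.
move=> x xt; have -> : x = t by lia.
by lia.
Qed.

(** The leaf condition at a peak under e bounds the label of e at every abscissa
    under e, by monotonicity of the labels towards the root. *)
Lemma labelling_le_gap n (e : edge beta) z : labellings alpha beta n ->
  ((ends e).1.-1 <= z <= (ends e).2)%N -> (n e)%:Z <= gap z.
Proof.
move=> nlab ze; have pe := edge_prime e; have [e12 eN _ _] := pe.
rewrite size_tuple in eN.
have [t [te up down tz]] := exists_peak_le_gap pe ze.
have [f fE] := @prime_edge _ (t, t.+1) (@peak_prime t ltac:(lia) up down).
have fleaf : leaf_edge f.
  apply/existsP => -[g]; rewrite parent_edgeE => /andP[fg _].
  have [g12 _ _ _] := edge_prime g.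
  by move: fg; rewrite /encloses fE /=; lia.
have nf : (n f)%:Z <= gap t.
  by case: nlab => /(_ f fleaf) + _; rewrite capacityE fE.
have := @labelling_nested alpha beta n e f nlab; rewrite fE /= => ef.
apply: le_trans tz; apply: le_trans nf.
by apply: ef; lia.
Qed.

(** * The blocks of a labelling *)

Definition level_box (k x : nat) : box :=
  (x%:Z, height beta x + 1 + 2 * k%:Z).

Lemma level_box_inj k x l y : level_box k x = level_box l y -> k = l /\ x = y.
Proof. by case=> -[xy]; rewrite xy; lia. Qed.

Lemma below_level_box k x : below (level_box k.+1 x) = level_box k x.
Proof. by rewrite /below /level_box /=; congr pair; lia. Qed.

Definition covered (n : {ffun edge beta -> nat}) k t : bool :=
  [exists e : edge beta,
    [&& ((ends e).1 <= t)%N, (t <= (ends e).2)%N & (k < n e)%N]].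

(** The intervals of the partition at level k are the classes of this
    relation. *)
Definition linked n k x y : Prop :=
  forall t, (minn x y < t <= maxn x y)%N -> covered n k t.

Definition block n k x : set box :=
  [set b | exists2 y, linked n k x y & b = level_box k y].

Definition strips n : set (set box) :=
  [set D | exists k x, [/\ (x <= N)%N, k%:Z < gap x & D = block n k x]].

Lemma linked_refl n k x : linked n k x x.
Proof. by move=> t; lia. Qed.

Lemma linked_sym n k x y : linked n k x y -> linked n k y x.
Proof. by move=> xy t; rewrite minnC maxnC; apply: xy. Qed.

Lemma linked_trans n k y x z :
  linked n k x y -> linked n k y z -> linked n k x z.
Proof.
move=> xy yz t xzt.
have /orP[/xy//|/yz//] :
  (minn x y < t <= maxn x y)%N || (minn y z < t <= maxn y z)%N by lia.
Qed.

Lemma linked_sub n k x y x' y' : linked n k x y ->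
  (minn x y <= minn x' y')%N -> (maxn x' y' <= maxn x y)%N -> linked n k x' y'.
Proof. by move=> xy mi ma t xyt; apply: xy; lia. Qed.

Lemma linked_le n k l x y : (k <= l)%N -> linked n l x y -> linked n k x y.
Proof.
move=> kl xy t /xy /existsP[e /and3P[e1 e2 e3]].
by apply/existsP; exists e; rewrite e1 e2 (leq_ltn_trans kl e3).
Qed.

Lemma linked_edge n k (e : edge beta) x y : (k < n e)%N ->
    ((ends e).1.-1 <= x <= (ends e).2)%N ->
    ((ends e).1.-1 <= y <= (ends e).2)%N ->
  linked n k x y.
Proof.
move=> kn ex ey t xyt; apply/existsP; exists e.
by rewrite kn andbT; lia.
Qed.

Lemma coveredP n k t : covered n k t -> exists2 e : edge beta,
  (k < n e)%N & ((ends e).1 <= t <= (ends e).2)%N.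
Proof. by case/existsP=> e /and3P[e1 e2 kn]; exists e; rewrite ?e1. Qed.

(** The class of an abscissa that has a box at level k stays inside the region:
    the last letter on the way to y is covered by an edge above y. *)
Lemma linked_gap n k x y : labellings alpha beta n ->
    (x <= N)%N -> k%:Z < gap x -> linked n k x y ->
  (y <= N)%N /\ k%:Z < gap y.
Proof.
move=> nlab xN kx xy; have [<-//|xy'] := eqVneq x y.
have [e ke ye] : exists2 e : edge beta, (k < n e)%N &
    ((ends e).1.-1 <= y <= (ends e).2)%N.
  have [ltxy|leyx] := ltnP x y.
    have /coveredP[e ke ye] : covered n k y by apply: xy; lia.
    by exists e; lia.
  have /coveredP[e ke ye] : covered n k y.+1 by apply: xy; lia.
  by exists e; lia.
have [_ eN _ _] := edge_prime e; rewrite size_tuple in eN.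
split; first lia.
by apply: lt_le_trans (labelling_le_gap nlab ye); rewrite ltz_nat.
Qed.

Lemma block_eq n k x y : linked n k x y -> block n k x = block n k y.
Proof.
move=> xy; apply/seteqP; split=> b [z xz ->]; exists z => //.
  by apply: linked_trans xz; apply: linked_sym.
exact: linked_trans xz.
Qed.

Lemma mem_block n k x l y : block n k x (level_box l y) <->
  k = l /\ linked n k x y.
Proof.
split=> [[z xz /level_box_inj[-> ->]]//|[<- xy]].
by exists y.
Qed.

Definition interval_strip k i j : set box :=
  [set b | exists2 z, (i <= z <= j)%N & b = level_box k z].

Lemma interval_strip_dyck k i j :
  dyck_interval beta i j -> dyck_strip (interval_strip k i j).
Proof.
case=> /andP[ij jN] hij hi.
exists i%:Z, (height beta i + 1 + 2 * k%:Z), (take (j - i) (drop i beta)).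
have wsz : size (take (j - i) (drop i beta)) = (j - i)%N.
  by rewrite size_takel // size_drop; lia.
have wh t : (t <= j - i)%N -> height (take (j - i) (drop i beta)) t =
    height beta (i + t) - height beta i.
  by move=> tji; rewrite height_take // height_drop.
split.
  rewrite /dyck_word wsz; split=> [|t tji]; rewrite wh ?subnKC ?hij ?subrr //.
  by rewrite -hij subr_ge0; apply: hi; lia.
rewrite wsz; apply/seteqP; split=> b.
  case=> z iz ->; exists (z - i)%N => /=; first lia.
  rewrite wh; last lia.
  by rewrite /level_box subnKC; [congr pair; lia|lia].
case=> t /= tji <-; exists (i + t)%N; first lia.
by rewrite wh // /level_box; congr pair; lia.
Qed.

(** From any z of the class [i, j], other than i, the covering edge of letter z
    leads back to an abscissa of the class that is not higher; iterating reaches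
    i, so h i is minimal. Symmetrically h j is minimal. *)
Lemma block_interval n k x : labellings alpha beta n ->
    (x <= N)%N -> k%:Z < gap x ->
  exists i j, dyck_interval beta i j /\ block n k x = interval_strip k i j.
Proof.
move=> nlab xN kx.
have lkN y : linked n k x y -> (y <= N)%N by case/(linked_gap nlab xN kx).
have exP : exists y, `[< linked n k x y >].
  by exists x; apply/asboolP; apply: linked_refl.
have ubP y : `[< linked n k x y >] -> (y <= N)%N by move/asboolP/lkN.
case: (ex_minnP exP) => i /asboolP xi imin.
case: (ex_maxnP exP ubP) => j /asboolP xj jmax.
have {}imin y : linked n k x y -> (i <= y)%N by move/asboolP/imin.
have {}jmax y : linked n k x y -> (y <= j)%N by move/asboolP/jmax.
have lij : linked n k i j by apply: linked_trans xj; apply: linked_sym.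
have lk y : (i <= y <= j)%N -> linked n k x y.
  by move=> iy; apply: linked_trans xi _; apply: linked_sub lij _ _; lia.
have ij : (i <= j)%N by apply: imin.
have hi z : (i <= z <= j)%N -> height beta i <= height beta z.
  elim/ltn_ind: z => z IHz iz; have [->//|zi] := eqVneq z i.
  have /coveredP[e ke ze] : covered n k z by apply: lij; lia.
  have [e12 _ _ _] := edge_prime e.
  (* All letters of e are covered, so its start is in the class too. *)
  have ie : (i <= (ends e).1.-1)%N.
    apply: imin; apply: linked_trans (lk z iz) _.
    by apply: linked_edge ke _ _; lia.
  have [_ _ he] := prime_pair_dyck (edge_prime e).
  by apply: le_trans (he z _); [apply: IHz; lia|lia].
have hj z : (i <= z <= j)%N -> height beta j <= height beta z.
  move: {2}(j - z)%N (leqnn (j - z)) => m.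
  elim: m z => [|m IHm] z zm iz; first by have -> : z = j by lia.
  have [->//|zj] := eqVneq z j.
  have /coveredP[e ke ze] : covered n k z.+1 by apply: lij; lia.
  have [e12 _ _ _] := edge_prime e.
  have je : ((ends e).2 <= j)%N.
    apply: jmax; apply: linked_trans (lk z iz) _.
    by apply: linked_edge ke _ _; lia.
  have [_ he12 he] := prime_pair_dyck (edge_prime e).
  apply: le_trans (he z _); last lia.
  by rewrite he12; apply: IHm; lia.
exists i, j; split.
  split=> //; first by rewrite ij size_tuple lkN.
  by apply/eqP; rewrite eq_le hi ?hj; lia.
apply/seteqP; split=> b [z xz ->]; exists z => //; last exact: lk.
by rewrite imin ?jmax.
Qed.

(** The labelling can be read off its strips, which gives injectivity: if the
    two ends of e are linked, its opening letter is covered by an edge that is e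
    or encloses e, whose label is at most that of e. *)
Lemma lt_labelP n k (e : edge beta) : labellings alpha beta n ->
  (k < n e)%N <-> exists2 D, strips n D &
    D (level_box k (ends e).1.-1) /\ D (level_box k (ends e).2).
Proof.
move=> nlab; have pe := edge_prime e; have [e12 eN _ _] := pe.
rewrite size_tuple in eN; split=> [kn|].
  exists (block n k (ends e).2).
    exists k, (ends e).2; split=> //.
    apply: lt_le_trans (labelling_le_gap nlab (_ : _ <= (ends e).2 <= _)%N).
      by rewrite ltz_nat; exact: kn.
    by lia.
  by split; apply/mem_block; split=> //; apply: linked_edge kn _ _; lia.
case=> _ [l [x [xN lx ->]]] [/mem_block[-> xi] /mem_block[_ xj]].
have ij := linked_trans (linked_sym xi) xj.
have /coveredP[g kg ge] : covered n k (ends e).1 by apply: ij; lia.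
apply: leq_trans kg _.
case: (prime_pair_laminar pe (edge_prime g) _ ge); first lia.
- by move/ends_inj => ->.
- by rewrite /encloses; lia.
- by rewrite /encloses => eg; apply: labelling_nested nlab _ _; lia.
Qed.

(** * Blocks of a labelling form a configuration *)

Hypothesis gap0 : gap 0 = 0.
Hypothesis gapN : gap N = 0.

(** The paths meet at abscissas 0 and N, so k < gap x forces 0 < x < N. *)
Lemma boxes_betweenP b : boxes_between alpha beta b <->
  exists k x, [/\ (x <= N)%N, k%:Z < gap x & b = level_box k x].
Proof.
split=> [[x [b1 xN bodd bh]]|[k [x [xN kx ->]]]].
  have xN' : (x <= N)%N by lia.
  rewrite gap_height // in bh.
  move: bodd; rewrite b1 => bodd.
  have hx := @height_count beta x; rewrite size_tuple in hx.
  have hx' := hx xN'.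
  exists (absz (b.2 - height beta x - 1)%R)./2, x.
  rewrite /level_box -b1; case: b b1 bodd bh => b1 b2 /= _ bodd bh.
  (* The height at x has the parity of x, so b2 - h x - 1 is even. *)
  have h : (absz (b2 - height beta x - 1)%R)./2%:Z * 2 = b2 - height beta x - 1.
    by lia.
  split; [lia|lia|by congr pair; lia].
exists x; split=> //=.
- suff : x != 0%N /\ x != N by lia.
  by split; apply/eqP => xE; rewrite xE ?gap0 ?gapN in kx.
- have hx := @height_count beta x; rewrite size_tuple in hx.
  have hx' := hx xN; lia.
- by rewrite gap_height //; lia.
Qed.

(** Rule I holds because linking at level k + 1 implies linking at level k. *)
Lemma strips_configuration n :
  labellings alpha beta n -> configurations alpha beta (strips n).
Proof.
move=> nlab; split.
- split.
  + apply/seteqP; split=> b.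
      case=> D [k [x [xN kx ->]]] [y xy ->]; apply/boxes_betweenP.
      by have [yN ky] := linked_gap nlab xN kx xy; exists k, y.
    case/boxes_betweenP=> k [x [xN kx ->]].
    exists (block n k x); first by exists k, x.
    by exists x => //; apply: linked_refl.
  + move=> _ _ [k [x [xN kx ->]]] [l [y [yN ly ->]]] [b [[z xz ->]]].
    case/mem_block=> lk yz; rewrite lk in yz *; apply: block_eq.
    by apply: linked_trans xz _; apply: linked_sym.
  + move=> _ [k [x [xN kx ->]]]; exists (level_box k x).
    by exists x => //; apply: linked_refl.
- move=> _ [k [x [xN kx ->]]].
  have [i [j [dij ->]]] := block_interval nlab xN kx.
  exact: interval_strip_dyck.
- move=> _ _ [k [x [xN kx ->]]] [l [y [yN ly ->]]] _ [b [z yz ->]].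
  case: l ly yz => [|l] ly yz.
    by case=> u _; rewrite /below /level_box /= => -[[->]]; lia.
  rewrite below_level_box => /mem_block[kl xz].
  move=> _ [u yu ->]; rewrite below_level_box; apply/mem_block; split=> //.
  apply: linked_trans xz _; rewrite kl.
  by apply: linked_le (leqnSn l) _; apply: linked_trans yu; apply: linked_sym.
Qed.

(** * Every configuration comes from a labelling *)

Section Configuration.
Variable C : set (set box).
Hypothesis CP : configurations alpha beta C.

Lemma configuration_box D b : C D -> D b ->
  exists k x, [/\ (x <= N)%N, k%:Z < gap x & b = level_box k x].
Proof.
case: CP => -[cover _ _] _ _ CD Db; apply/boxes_betweenP.
by rewrite -cover; exists D.
Qed.

Lemma configuration_cover k x : (x <= N)%N -> k%:Z < gap x ->
  exists2 D, C D & D (level_box k x).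
Proof.
case: CP => -[cover _ _] _ _ xN kx.
have : boxes_between alpha beta (level_box k x).
  by apply/boxes_betweenP; exists k, x.
by rewrite -cover => -[D CD Dx]; exists D.
Qed.

Lemma configuration_disjoint D D' b : C D -> C D' -> D b -> D' b -> D = D'.
Proof.
by case: CP => -[_ triv _] _ _ CD CD' Db D'b; apply: triv => //; exists b.
Qed.

(** A strip has a single box in each column. *)
Lemma configuration_column D b : C D -> D b -> ~ D (below b).
Proof.
case: CP => _ Cdyck _ /Cdyck[x [y [w [_ ->]]]] [i _ <-] [j _ /=].
rewrite /below /= => -[/addrI[->]]; lia.
Qed.

(** Rule I applies to D and the strip that contains the box below (k + 1, x):
    they are distinct because D has a single box in that column. *)
Lemma configuration_below D k x : C D -> D (level_box k.+1 x) ->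
  exists2 D', C D' & forall b, D b -> D' (below b).
Proof.
move=> CD Dx.
have [l [y [yN ly /level_box_inj[lE yE]]]] := configuration_box CD Dx.
have [|D' CD' D'x] := @configuration_cover k y yN; first by lia.
exists D' => //; have [_ _ rule] := CP; apply: rule => //.
  move=> DD'; rewrite DD' in D'x; apply: (configuration_column CD Dx).
  by rewrite below_level_box yE.
by exists (level_box k.+1 x) => //; rewrite below_level_box yE.
Qed.

(** By induction on the lower level: the strip just below D contains the
    translates of all the boxes of D, and the translate of a box at level 0
    would lie below beta. *)
Lemma configuration_level D k x l y : C D ->
  D (level_box k x) -> D (level_box l y) -> k = l.
Proof.
wlog : k x l y / (k <= l)%N => [wlg|].
  move=> CD Dx Dy; have [kl|lk] := leqP k l; first exact: (wlg k x l y).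
  by rewrite (wlg l y k x) // ltnW.
elim: k D x l y => [|k IHk] D x [|l] y // kl CD Dx Dy.
  have [D' CD' sub] := configuration_below CD Dy.
  have [m [z [_ _]]] := configuration_box CD' (sub _ Dx).
  by rewrite /below /level_box /= => -[[->]]; lia.
have [D' CD' sub] := configuration_below CD Dx.
congr S; apply: (IHk D' x l y) => //; rewrite -below_level_box; exact: sub.
Qed.

(** The boxes of D are all at the same height above beta, so the Dyck path of
    their centers is a translate of a piece of beta. *)
Lemma configuration_interval D : C D ->
  exists k i j, dyck_interval beta i j /\ D = interval_strip k i j.
Proof.
move=> CD; have [_ /(_ D CD)[x0 [y0 [w [[w0 wge] DE]]]] _] := CP.
have D0 : D (x0, y0).
  by rewrite DE; exists 0%N => //=; rewrite height0 !addr0.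
have [k [x [xN kx [x0E y0E]]]] := configuration_box CD D0.
have Dw i : (i <= size w)%N -> (x + i <= N)%N /\
    (x0 + i%:Z, y0 + height w i) = level_box k (x + i).
  move=> iw; have Di : D (x0 + i%:Z, y0 + height w i) by rewrite DE; exists i.
  have [l [z [zN lz zE]]] := configuration_box CD Di.
  have kl : k = l.
    apply: (@configuration_level D k x l z) => //; last by rewrite -zE.
    by rewrite /level_box -x0E -y0E.
  have -> : (x + i = z)%N by case: zE; lia.
  by rewrite kl.
have hw i : (i <= size w)%N -> height beta (x + i) = height beta x + height w i.
  by move=> /Dw[_ []]; lia.
exists k, x, (x + size w)%N; split.
  split; first by rewrite leq_addr size_tuple; case: (Dw _ (leqnn _)).
  - by rewrite hw // w0 addr0.
  - move=> z xz; have := hw (z - x)%N; have := wge (z - x)%N.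
    by rewrite subnKC; lia.
rewrite DE; apply/seteqP; split=> b.
  case=> i /= iw <-; exists (x + i)%N; first lia.
  by case: (Dw i iw).
case=> z xz ->; exists (z - x)%N => /=; first lia.
have [|_ ->] := Dw (z - x)%N; first lia.
by congr level_box; lia.
Qed.

(** For fixed k, these edges form the k-th set of the decreasing chain that C
    defines. *)
Definition joined k (e : edge beta) : Prop :=
  exists2 D, C D & D (level_box k (ends e).1.-1) /\ D (level_box k (ends e).2).

Lemma joined_le k l e : (k <= l)%N -> joined l e -> joined k e.
Proof.
elim: l => [|l IHl] kl; first by have -> : k = 0%N by lia.
have [->//|kl'] := eqVneq k l.+1.
case=> D CD [D1 D2]; apply: IHl; first lia.
have [D' CD' sub] := configuration_below CD D1.
by exists D' => //; split; rewrite -below_level_box; apply: sub.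
Qed.

Lemma joined_strip k (e : edge beta) z : joined k e ->
  ((ends e).1.-1 <= z <= (ends e).2)%N -> exists2 D, C D &
    D (level_box k (ends e).2) /\ D (level_box k z).
Proof.
case=> D CD [D1 D2] ez; exists D => //; split => //.
have [l [i [j [dij DE]]]] := configuration_interval CD.
move: D1 D2; rewrite DE.
move=> -[u iu /level_box_inj[-> u1]] [v iv /level_box_inj[_ v2]].
by exists z => //; lia.
Qed.

(** The levels at which e is joined are downward closed, by Rule I, and bounded
    by the number of boxes over the end of e. *)
Lemma exists_label (e : edge beta) :
  exists m, forall k, joined k e <-> (k < m)%N.
Proof.
have exP : exists k, `[< ~ joined k e >].
  have [e12 eN _ _] := edge_prime e; rewrite size_tuple in eN.
  exists `|gap (ends e).2|%N; apply/asboolP => -[D CD [_ De]].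
  have [l [x [_ lx /level_box_inj[lE xE]]]] := configuration_box CD De.
  by rewrite -xE -lE in lx; lia.
case: (ex_minnP exP) => m /asboolP jm mmin; exists m => k; split=> [jk|km].
  by rewrite ltnNge; apply/negP => /joined_le/(_ jk).
by apply: contrapT => /asboolP/mmin; lia.
Qed.

(** The box at level n e - 1 over the opening letter of e lies between the paths,
    which bounds n e by the capacity; a strip that contains the ends of an edge
    contains those of the edges enclosed by it. *)
Lemma labels_labelling n :
    (forall x, (x <= N)%N -> 0 <= gap x) ->
    (forall e k, joined k e <-> (k < n e)%N) ->
  labellings alpha beta n.
Proof.
move=> nonneg nP; split=> [e _|e e'].
  have [e12 eN _ _] := edge_prime e; rewrite size_tuple in eN.
  rewrite capacityE; change ((n e)%:Z <= gap (ends e).1).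
  case nE : (n e) => [|m]; first by apply: nonneg; lia.
  have /joined_strip : joined m e by apply/nP; rewrite nE.
  move=> /(_ (ends e).1)[|D CD [_ De]]; first lia.
  have [l [x [_ lx /level_box_inj[lE xE]]]] := configuration_box CD De.
  by rewrite -xE -lE in lx; lia.
rewrite parent_edgeE => /andP[ee' _].
rewrite leqNgt; apply/negP => lt; have /nP[D CD [D1 D2]] := lt.
suff /nP : joined (n e) e by rewrite ltnn.
have [l [i [j [dij DE]]]] := configuration_interval CD.
have [e12 eN _ _] := edge_prime e.
move: D1 D2; rewrite DE.
move=> -[u iu /level_box_inj[lE u1]] [v iv /level_box_inj[_ v2]].
move: ee'; rewrite /encloses => ee'.
by exists D => //; rewrite DE -lE; split; eexists; try reflexivity; lia.
Qed.

(** A strip is the interval strip of a Dyck interval [i, j]. Its letters are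
    covered by matched pairs inside [i, j], whose ends lie in the strip, so
    [i, j] is linked. Conversely an edge joined at that level and with an
    abscissa in [i, j] has both ends in a strip that meets this one, hence in
    [i, j]: no link leaves the interval. *)
Lemma strips_labels n :
  (forall e k, joined k e <-> (k < n e)%N) -> strips n = C.
Proof.
move=> nP.
have CE D k x : C D -> D (level_box k x) -> D = block n k x.
  move=> CD; have [l [i [j [dij DE]]]] := configuration_interval CD.
  have jN : (j <= N)%N by case: dij; rewrite size_tuple; lia.
  rewrite {1}DE => -[x' ix /level_box_inj[kl xx']]; rewrite -{x'}xx' in ix.
  rewrite -{l}kl in DE.
  have lk u v : (i <= u <= j)%N -> (i <= v <= j)%N -> linked n k u v.
    move=> iu iv t uvt.
    have [|p pp [ip pt pj]] := @dyck_interval_cover beta i j t dij; first lia.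
    have [e eE] := prime_edge pp.
    apply/existsP; exists e; rewrite eE.
    have [p12 _ _ _] := pp.
    suff -> : (k < n e)%N by lia.
    apply/nP; exists D => //; rewrite eE DE.
    by split; eexists; try reflexivity; lia.
  have edge_in e u : (k < n e)%N -> (i <= u <= j)%N ->
      ((ends e).1.-1 <= u <= (ends e).2)%N ->
      (i <= (ends e).1.-1)%N && ((ends e).2 <= j)%N.
    move=> /nP je iu eu; have [D' CD' [De Du]] := joined_strip je eu.
    have DD' : D' = D.
      by apply: (configuration_disjoint CD' CD Du); rewrite DE; exists u.
    have [D'' CD'' [D1 D2]] := je.
    have D''D : D'' = D.
      by apply: (configuration_disjoint CD'' CD D2); rewrite -DD'.
    move: D1 D2; rewrite D''D DE.
    move=> [a ia /level_box_inj[_ ->]] [c ic /level_box_inj[_ ->]].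
    by lia.
  rewrite DE; apply/seteqP; split=> b [z iz ->]; exists z => //.
    exact: lk.
  apply: contrapT => niz.
  (* A link leaving [i, j] would cover letter j + 1 or letter i. *)
  have [jz|zi] : (j < z)%N \/ (z < i)%N by lia.
    have /coveredP[e ke je] : covered n k j.+1 by apply: iz; lia.
    by have := edge_in e j ke; lia.
  have /coveredP[e ke je] : covered n k i by apply: iz; lia.
  by have := edge_in e i ke; have [e12 _ _ _] := edge_prime e; lia.
apply/seteqP; split=> D.
  case=> k [x [xN kx ->]]; have [D' CD' D'x] := configuration_cover xN kx.
  by rewrite -(CE D').
move=> CD; have [l [i [j [dij DE]]]] := configuration_interval CD.
have Di : D (level_box l i) by rewrite DE; exists i => //; case: dij; lia.
have [k [x [xN kx /level_box_inj[lE xE]]]] := configuration_box CD Di.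
by exists k, x; split=> //; apply: CE => //; rewrite -lE -xE.
Qed.

End Configuration.
End Gap.
End Heights.

Theorem theorem8 (N K : nat) (hN : (1 <= N)%N) (hK : (K <= N)%N)
  (alpha beta : N.-tuple bool)
  (halpha : lattice_paths N K alpha) (hbeta : lattice_paths N K beta)
  (habove : weakly_above alpha beta) :
  exists f : {ffun edge beta -> nat} -> set (set box),
    set_bij (labellings alpha beta) (configurations alpha beta) f.
Proof.
have gap0 : gap alpha beta 0 = 0%R by rewrite /gap !take0.
have gapN : gap alpha beta N = 0%R.
  have := @gap_height N alpha beta N (leqnn N).
  by rewrite halpha hbeta; lia.
have gap_ge0 x : (x <= N)%N -> (0 <= gap alpha beta x)%R.
  by move=> xN; have := habove x xN; rewrite (@gap_height N alpha beta) //; lia.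
exists (@strips N alpha beta); split.
- by move=> n; apply: strips_configuration.
- move=> n n' /set_mem nlab /set_mem nlab' nn'; apply/ffunP => e.
  have same k : (k < n e)%N <-> (k < n' e)%N.
    by rewrite (lt_labelP k e nlab) nn' -(lt_labelP k e nlab').
  apply/eqP; rewrite eqn_leq; apply/andP.
  by split; rewrite leqNgt; apply/negP => /same; rewrite ltnn.
- move=> C CP.
  have [m mP] := choice (exists_label gap0 gapN CP).
  have nP e k : joined C k e <-> (k < [ffun e => m e] e)%N by rewrite ffunE.
  exists [ffun e => m e]; first exact: labels_labelling gap_ge0 nP.
  exact: strips_labels nP.
Qed.
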